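(* Consider the rank-constrained problem $$\underset{\zeta}{\text{minimize}}\quad \varepsilon_{\mathcal S}+\lambda_1\varepsilon_y+\lambda_2\|W\circ K\|_1\qquad\text{subject to (L) and } \mathbf{rank}(M_2)=2n,\tag{R1}$$ and the auxiliary problem $$\begin{aligned}\underset{Y,\zeta}{\text{minimize}}\quad & \varepsilon_{\mathcal S}+\lambda_1\varepsilon_y+\lambda_2\|W\circ K\|_1+\nu\,\mathbf{Tr}(YM_2)\\ \text{subject to}\quad & \text{(L)},\quad 0\preceq Y\preceq I_{6n+m},\quad \mathbf{Tr}(Y)=4n+m,\quad M_2\succeq 0,\end{aligned}\tag{R2}$$ where $\lambda_1,\lambda_2,\nu>0$ and the entry-wise positive matrix $W\in\mathbb{R}^{m\times q}$ are given design parameters, and where the decision variables $\zeta$, the matrix $M_2$ and the constraint set (L) are as specified in the context. If problem (R1) is feasible, then there exists a constant $\eta>0$, not depending on $\nu$, for which the optimal solution $M_2$ obtained from solving (R2) satisfies $$\mathbf{rank}(M_2;\eta\nu^{-1})\le 2n,$$ i.e. the rank of $M_2$ is less than or equal to $2n$ with tolerance threshold $\eta\nu^{-1}$.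
   Context: Rank with tolerance: for $\epsilon>0$ and a matrix $X$, the rank of $X$ is $k$ with tolerance $\epsilon$, written $\mathbf{rank}(X;\epsilon)=k$, if exactly $k$ singular values of $X$ are larger than or equal to $\epsilon$. Data: real matrices $A\in\mathbb{R}^{n\times n}$, $B_1\in\mathbb{R}^{n\times m}$, $B_2\in\mathbb{R}^{n\times p}$, $C\in\mathbb{R}^{q\times n}$ with $(A,B_1)$ controllable and $(A,C)$ detectable; uncertainty-structure matrices $D\in\mathbb{R}^{n\times i}$, $E_A\in\mathbb{R}^{j\times n}$, $E_{B_1}\in\mathbb{R}^{j\times m}$ and level $\rho\ge0$; a given pre-designed feedback gain $\hat{K}\in\mathbb{R}^{m\times q}$; a convex set $\mathcal{K}\subseteq\mathbb{R}^{m\times q}$. Put $$\bar{B}=\begin{bmatrix}B_2^{\mathrm T} & B_2^{\mathrm T}\end{bmatrix}^{\mathrm T},\ \ \bar{C}=\begin{bmatrix}C & -C\end{bmatrix},\ \ A_o=\mathbf{diag}(A,\,A+B_1\hat{K}C),\ \ \bar{D}=\begin{bmatrix}D^{\mathrm T} & 0\end{bmatrix}^{\mathrm T}\in\mathbb{R}^{2n\times i},$$ $$E_o=\begin{bmatrix}E_A & 0\end{bmatrix}\in\mathbb{R}^{j\times 2n},\ \ C_K=\begin{bmatrix}C & 0\end{bmatrix}\in\mathbb{R}^{q\times 2n},\ \ B_K=\begin{bmatrix}B_1^{\mathrm T} & 0\end{bmatrix}^{\mathrm T}\in\mathbb{R}^{2n\times m}.$$ Decision variables $\zeta$: $K\in\mathbb{R}^{m\times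 q}$, scalars $\varepsilon_y,\varepsilon_{\mathcal S},\varepsilon_1,\varepsilon_2$, symmetric $X_1,X_2\in\mathbb{R}^{2n\times 2n}$, $Y_1,Y_2\in\mathbb{R}^{2n\times m}$, and the free blocks (marked ''$-$'') of the symmetric $(6n+m)\times(6n+m)$ matrix $$M_2=\begin{bmatrix}X_1 & * & * & *\\ Y_1^{\mathrm T} & - & * & *\\ X_2 & Y_2 & - & *\\ I_{2n} & (KC_K)^{\mathrm T} & - & -\end{bmatrix}.$$ (The additional variable $Y$ in (R2) is a symmetric $(6n+m)\times(6n+m)$ matrix.) With $$Q_r=X_rA_o^{\mathrm T}+A_oX_r+Y_rB_K^{\mathrm T}+B_KY_r^{\mathrm T},\qquad R_r=E_oX_r+E_{B_1}Y_r^{\mathrm T}\qquad(r=1,2),$$ the constraint set (L) consists of: $K\in\mathcal{K}$; $X_r\succ0$ and $\varepsilon_r>0$ for $r=1,2$; $\mathbf{Tr}(\bar{C}X_1\bar{C}^{\mathrm T})<\varepsilon_{\mathcal S}$; $$\begin{bmatrix}Q_1+\bar{B}\bar{B}^{\mathrm T}+\varepsilon_1\rho\,\bar{D}\bar{D}^{\mathrm T} & *\\ \sqrt{\rho}\,R_1 & -\varepsilon_1I_j\end{bmatrix}\prec 0;\qquad \begin{bmatrix}Q_2+\varepsilon_2\rho\,\bar{D}\bar{D}^{\mathrm T} & * & * & *\\ \bar{B}^{\mathrm T} & -\varepsilon_yI_p & * & *\\ \bar{C}X_2 & 0 & -\varepsilon_yI_q & *\\ \sqrt{\rho}\,R_2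 & 0 & 0 & -\varepsilon_2I_j\end{bmatrix}\prec 0.$$ Notation: $\circ$ is the entry-wise (Hadamard) product; $\|\cdot\|_1$ is the entry-wise $\ell_1$ norm; $X\succ0$ ($X\succeq 0$) means symmetric positive definite (semidefinite), $X\prec0$ means $-X\succ0$, $X\preceq Y$ means $Y-X\succeq0$; $\mathbf{diag}$ forms a block diagonal matrix; ''$*$'' denotes an upper-triangular block determined by symmetry; ''$-$'' denotes a free block (diagonal ones symmetric), the whole matrix being symmetric. *)

(* Defs.v *)
(* MathComp / MathComp-Analysis *)
From HB Require Import structures.
From mathcomp Require Import all_boot all_order all_algebra.
From mathcomp Require Import all_classical all_reals all_analysis.

Set Implicit Arguments.
Unset Strict Implicit.
Unset Printing Implicit Defensive.

Import Order.TTheory GRing.Theory Num.Theory.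
Import numFieldNormedType.Exports.

Local Open Scope classical_set_scope.
Local Open Scope ring_scope.

Section MatrixNotions.
Variable R : realType.

Definition posdefmx n (X : 'M[R]_n) :=
  X^T = X /\ forall v : 'cV[R]_n, v != 0 -> 0 < (v^T *m X *m v) ord0 ord0.

Definition possemidefmx n (X : 'M[R]_n) :=
  X^T = X /\ forall v : 'cV[R]_n, 0 <= (v^T *m X *m v) ord0 ord0.

Definition negdefmx n (X : 'M[R]_n) := posdefmx (- X).

Definition lemx n (X Y : 'M[R]_n) := possemidefmx (Y - X).

Definition hadamard m n (X Y : 'M[R]_(m, n)) : 'M[R]_(m, n) :=
  map2_mx *%R X Y.

Definition entry_l1norm m n (X : 'M[R]_(m, n)) : R :=
  \sum_(a < m) \sum_(b < n) `|X a b|.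

(* The block matrix whose upper right block is determined by symmetry. *)
Definition symblock_mx n1 n2 (Xul : 'M[R]_n1) (Xdl : 'M[R]_(n2, n1))
    (Xdr : 'M[R]_n2) : 'M[R]_(n1 + n2) :=
  block_mx Xul Xdl^T Xdl Xdr.

(* s lists, with multiplicity, the nonnegative square roots of the eigenvalues
   of X^T X; s is determined by X up to order.  It has n entries, so when m < n
   it pads the min(m, n) singular values of X with zeros, which no positive
   tolerance counts. *)
Definition singular_values m n (X : 'M[R]_(m, n)) (s : seq R) :=
  (forall sigma, sigma \in s -> 0 <= sigma) /\
  char_poly (X^T *m X) = \prod_(sigma <- s) ('X - (sigma ^+ 2)%:P).

(* rank(X; eps) = k *)
Definition rank_tol_is m n (X : 'M[R]_(m, n)) (eps : R) (k : nat) :=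
  exists2 s : seq R, singular_values X s & count (fun sigma => eps <= sigma) s = k.

End MatrixNotions.

Section LinearSystems.
Variable R : realType.

(* x' = f on the whole time line, coordinate by coordinate. *)
Definition solves n (x f : R -> 'cV[R]_n) :=
  forall (t : R) (a : 'I_n),
    is_derive t 1 (fun s => x s a ord0) (f t a ord0).

(* For x' = A x + B u: every state can be steered to every other one in any
   positive time by a continuous input. *)
Definition controllable n m (A : 'M[R]_n) (B : 'M[R]_(n, m)) :=
  forall (x0 x1 : 'cV[R]_n) (T : R), 0 < T ->
  exists (u : R -> 'cV[R]_m) (x : R -> 'cV[R]_n),
    [/\ forall a, continuous (fun t => u t a ord0),
        solves x (fun t => A *m x t + B *m u t),
        x 0 = x0 & x T = x1].

(* For x' = A x, y = C x: an identically zero output forces x to vanish at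
   infinity. *)
Definition detectable n q (A : 'M[R]_n) (C : 'M[R]_(q, n)) :=
  forall x : R -> 'cV[R]_n,
    solves x (fun t => A *m x t) ->
    (forall t, 0 <= t -> C *m x t = 0) ->
    forall a, x t a ord0 @[t --> +oo] --> (0 : R).

End LinearSystems.

Record problem_data (R : realType) (n m p q i j : nat) := ProblemData {
  dA : 'M[R]_n;
  dB1 : 'M[R]_(n, m);
  dB2 : 'M[R]_(n, p);
  dC : 'M[R]_(q, n);
  dD : 'M[R]_(n, i);
  dEA : 'M[R]_(j, n);
  dEB1 : 'M[R]_(j, m);
  drho : R;
  dKhat : 'M[R]_(m, q);
  dKset : set 'M[R]_(m, q)
}.

(* The decision variables zeta.  The zFab are the free blocks of M2, in block
   row a and block column b. *)
Record decision (R : realType) (n m q : nat) := Decision {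
  zK : 'M[R]_(m, q);
  zeps_y : R;
  zeps_S : R;
  zeps1 : R;
  zeps2 : R;
  zX1 : 'M[R]_(n + n);
  zX2 : 'M[R]_(n + n);
  zY1 : 'M[R]_(n + n, m);
  zY2 : 'M[R]_(n + n, m);
  zF22 : 'M[R]_m;
  zF33 : 'M[R]_(n + n);
  zF43 : 'M[R]_(n + n);
  zF44 : 'M[R]_(n + n)
}.

Section Problems.
Variables (R : realType) (n m p q i j : nat).
Variable P : problem_data R n m p q i j.

Local Notation A := (dA P).
Local Notation B1 := (dB1 P).
Local Notation B2 := (dB2 P).
Local Notation C := (dC P).
Local Notation D := (dD P).
Local Notation EA := (dEA P).
Local Notation EB1 := (dEB1 P).
Local Notation rho := (drho P).
Local Notation Khat := (dKhat P).
Local Notation decision := (decision R n m q).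

(* The order 6n + m of M2, bracketed as its nested blocks. *)
Definition M2_dim := ((n + n) + (m + ((n + n) + (n + n))))%N.

Definition Bbar : 'M[R]_(n + n, p) := col_mx B2 B2.
Definition Cbar : 'M[R]_(q, n + n) := row_mx C (- C).
Definition Ao : 'M[R]_(n + n) := block_mx A 0 0 (A + B1 *m Khat *m C).
Definition Dbar : 'M[R]_(n + n, i) := col_mx D 0.
Definition Eo : 'M[R]_(j, n + n) := row_mx EA 0.
Definition CK : 'M[R]_(q, n + n) := row_mx C 0.
Definition BK : 'M[R]_(n + n, m) := col_mx B1 0.

Definition Qmx (X : 'M[R]_(n + n)) (Y : 'M[R]_(n + n, m)) : 'M[R]_(n + n) :=
  X *m Ao^T + Ao *m X + Y *m BK^T + BK *m Y^T.

Definition Rmx (X : 'M[R]_(n + n)) (Y : 'M[R]_(n + n, m)) : 'M[R]_(j, n + n) :=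
  Eo *m X + EB1 *m Y^T.

Definition M2 (z : decision) : 'M[R]_M2_dim :=
  let KCKt := (zK z *m CK)^T in
  symblock_mx (zX1 z) (col_mx (zY1 z)^T (col_mx (zX2 z) 1%:M))
    (symblock_mx (zF22 z) (col_mx (zY2 z) KCKt)
      (symblock_mx (zF33 z) (zF43 z) (zF44 z))).

Definition lmi1 (z : decision) : 'M[R]_((n + n) + j) :=
  symblock_mx
    (Qmx (zX1 z) (zY1 z) + Bbar *m Bbar^T
       + (zeps1 z * rho) *: (Dbar *m Dbar^T))
    (Num.sqrt rho *: Rmx (zX1 z) (zY1 z))
    (- (zeps1 z)%:M).

Definition lmi2 (z : decision) : 'M[R]_((n + n) + (p + (q + j))) :=
  symblock_mx
    (Qmx (zX2 z) (zY2 z) + (zeps2 z * rho) *: (Dbar *m Dbar^T))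
    (col_mx Bbar^T
      (col_mx (Cbar *m zX2 z) (Num.sqrt rho *: Rmx (zX2 z) (zY2 z))))
    (symblock_mx (- (zeps_y z)%:M) 0
      (symblock_mx (- (zeps_y z)%:M) 0 (- (zeps2 z)%:M))).

Definition symmetric_variables (z : decision) :=
  [/\ (zX1 z)^T = zX1 z, (zX2 z)^T = zX2 z, (zF22 z)^T = zF22 z,
      (zF33 z)^T = zF33 z & (zF44 z)^T = zF44 z].

(* The constraint set (L). *)
Definition constraints_L (z : decision) :=
  [/\ dKset P (zK z),
      posdefmx (zX1 z) /\ posdefmx (zX2 z),
      0 < zeps1 z /\ 0 < zeps2 z,
      \tr (Cbar *m zX1 z *m Cbar^T) < zeps_S z &
      negdefmx (lmi1 z) /\ negdefmx (lmi2 z)].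

Definition feasible_R1 (z : decision) :=
  [/\ symmetric_variables z, constraints_L z & \rank (M2 z) = (2 * n)%N].

Definition feasible_R2 (Yz : 'M[R]_M2_dim * decision) :=
  let: (Y, z) := Yz in
  [/\ symmetric_variables z, constraints_L z,
      lemx 0 Y /\ lemx Y 1%:M,
      \tr Y = (4 * n + m)%:R & possemidefmx (M2 z)].

Definition cost_R1 (lambda1 lambda2 : R) (W : 'M[R]_(m, q)) (z : decision) :=
  zeps_S z + lambda1 * zeps_y z + lambda2 * entry_l1norm (hadamard W (zK z)).

Definition cost_R2 (lambda1 lambda2 nu : R) (W : 'M[R]_(m, q))
    (Yz : 'M[R]_M2_dim * decision) :=
  cost_R1 lambda1 lambda2 W Yz.2 + nu * \tr (Yz.1 *m M2 Yz.2).

(* Identifies the space of variables of (R2) with a product of matrix spaces,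
   from which it takes its topology. *)
Definition coords (Yz : 'M[R]_M2_dim * decision) :=
  let: (Y, z) := Yz in
  (Y, zK z, zeps_y z, zeps_S z, zeps1 z, zeps2 z, zX1 z, zX2 z, zY1 z, zY2 z,
   zF22 z, zF33 z, zF43 z, zF44 z).

(* Optimal solutions of (R2): limits of feasible points whose cost is the
   infimum of the cost over the feasible set.  Every feasible minimizer is one
   (subset_closure).  The closure is needed because the strict inequality
   Tr(Cbar X1 Cbar^T) < eps_S leaves eps_S, which is being minimized, free to
   decrease at every feasible point: no feasible point attains the infimum. *)
Definition optimal_R2 (lambda1 lambda2 nu : R) (W : 'M[R]_(m, q))
    (Yz : 'M[R]_M2_dim * decision) :=
  closure (coords @` feasible_R2) (coords Yz) /\
  forall Yz', feasible_R2 Yz' ->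
    cost_R2 lambda1 lambda2 nu W Yz <= cost_R2 lambda1 lambda2 nu W Yz'.

End Problems.

(* Main.v *)
Require Import Defs.
From HB Require Import structures.
From mathcomp Require Import all_boot all_order all_algebra.
From mathcomp Require Import all_classical all_reals all_analysis.
From mathcomp Require Import complex zify lra.

Set Implicit Arguments.
Unset Strict Implicit.
Unset Printing Implicit Defensive.

Import Order.TTheory GRing.Theory Num.Theory.
Import numFieldNormedType.Exports.
Local Open Scope classical_set_scope.
Local Open Scope ring_scope.

(** Let N = 6n + m be the order of M2.  A point z0 feasible for (R1) lifts to a
    point feasible for (R2) whose penalty Tr(Y0 M2) vanishes.  Indeed X1 is
    invertible of order 2n, so rank M2 = 2n forces the Schur complement of X1 to
    vanish: M2 = G X1 G^T with G = [I; S], which is positive semidefinite, and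
    the orthogonal projection Y0 onto the kernel of G^T satisfies 0 <= Y0 <= I,
    Tr Y0 = N - 2n = 4n + m and Y0 G = 0
    ([symblock_rank_factor], [kernel_projection], [feasible_R1_lift]).

    Hence the optimal value of (R2) is at most c0, the cost of z0 in (R1),
    whatever nu is.  At an optimal point (Y, z) the (R1) part of the cost is
    nonnegative, so nu Tr(Y M2) <= c0 and Tr(Y M2) < eta / nu for
    eta = |c0| + 1.

    A small Tr(Y M2) bounds the number of large eigenvalues.  Let u_i be an
    orthonormal basis of eigenvectors of M2, with eigenvalues l_i >= 0.  Then
    Tr(Y M2) is the sum of the l_i w_i, where w_i, the value of the quadratic
    form of Y at u_i, lies in [0, 1], and the w_i add up to N - 2n.  If k
    eigenvalues were at least t with k > 2n, the other w_i would add up to at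
    most N - k, so those k weights would add up to at least k - 2n >= 1 and
    Tr(Y M2) would be at least t ([rank_tol_of_trace_lt]).  The singular values
    of M2 are its eigenvalues, M2 being positive semidefinite.

    Two points concern the notion of optimal solution.  The optimum is only a
    limit of feasible points, so the facts used at (Y, z) are those closed under
    limits ([feasible_R2_closure], [cost_R1_ge0_closure]).  And eps_y is bounded
    below only through a diagonal entry of the second matrix inequality; when
    p = q = 0 there is no such entry, eps_y is free, the cost has no lower bound
    and there is no optimal solution at all. *)

(** * Positive semidefinite matrices *)

Section PositiveMatrices.
Variable R : realType.

Lemma quadform_delta n (X : 'M[R]_n) a :
  ((delta_mx a (ord0 : 'I_1))^T *m X *m delta_mx a (ord0 : 'I_1)) ord0 ord0 =
  X a a.
Proof. by rewrite trmx_delta -rowE -colE !mxE. Qed.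

Lemma posdefmx_diag_gt0 n (X : 'M[R]_n) a : posdefmx X -> 0 < X a a.
Proof.
move=> [_ /(_ (delta_mx a (ord0 : 'I_1)))]; rewrite quadform_delta; apply.
by apply/eqP => /matrixP /(_ a ord0) /eqP; rewrite !mxE !eqxx oner_eq0.
Qed.

Lemma posdefmx_possemidef n (X : 'M[R]_n) : posdefmx X -> possemidefmx X.
Proof.
move=> [symX posX]; split=> // v.
have [->|v0] := eqVneq v 0; first by rewrite mulmx0 mxE.
exact/ltW/posX.
Qed.

Lemma possemidefmx_congr n k (B : 'M[R]_(k, n)) (X : 'M[R]_n) :
  possemidefmx X -> possemidefmx (B *m X *m B^T).
Proof.
move=> [symX posX]; split=> [|v]; first by rewrite !trmx_mul trmxK symX mulmxA.
by have := posX (B^T *m v); rewrite trmx_mul trmxK !mulmxA.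
Qed.

Lemma possemidefmx_tr_ge0 n (X : 'M[R]_n) : possemidefmx X -> 0 <= \tr X.
Proof. by move=> [_ X0]; apply: sumr_ge0 => a _; rewrite -quadform_delta. Qed.

(** Such an E is E 1 E^T, a congruence of the identity. *)
Lemma possemidefmx_idempotent n (E : 'M[R]_n) :
  E^T = E -> E *m E = E -> possemidefmx E.
Proof.
move=> symE idemE.
rewrite -[E]idemE -{2}symE -[X in X *m _]mulmx1.
apply: possemidefmx_congr; split=> [|v]; first exact: trmx1.
by rewrite mulmx1 mxE sumr_ge0 // => k _; rewrite mxE -expr2 sqr_ge0.
Qed.

Lemma dot_gt0 n (v : 'cV[R]_n) : v != 0 -> 0 < (v^T *m v) ord0 ord0.
Proof.
move=> v0; rewrite mxE lt0r sumr_ge0 ?andbT => [|k _]; last first.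
  by rewrite mxE -expr2 sqr_ge0.
apply: contraNneq v0 => /psumr_eq0P s0; apply/eqP/colP => k; rewrite [RHS]mxE.
have /s0/(_ k isT)/eqP : forall l : 'I_n, true -> 0 <= v^T ord0 l * v l ord0.
  by move=> l _; rewrite mxE -expr2 sqr_ge0.
by rewrite mxE mulf_eq0 orbb => /eqP.
Qed.

(** A kernel vector would annihilate the quadratic form. *)
Lemma unitmx_nondegenerate n (X : 'M[R]_n) :
  (forall v : 'cV[R]_n, v != 0 -> 0 < (v^T *m X *m v) ord0 ord0) ->
  X \in unitmx.
Proof.
move=> posX; rewrite -row_free_unit -kermx_eq0; apply/negPn/negP.
move=> /rowV0Pn [u /sub_kermxP uX u0].
have /posX : u^T != 0 by rewrite -(inj_eq trmx_inj) trmxK trmx0.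
by rewrite trmxK uX mul0mx mxE ltxx.
Qed.

End PositiveMatrices.

(** * Spectral decomposition of real symmetric matrices *)

Lemma hermitian_diagonalization (C : numClosedFieldType) n (A : 'M[C]_n) :
  A \is hermsymmx ->
  exists (U : 'M[C]_n) (d : 'rV[C]_n), [/\ U \is unitarymx,
    d \is a mxOver Num.real & A = map_mx Num.conj U^T *m diag_mx d *m U].
Proof.
move=> hermA; exists (spectralmx A), (spectral_diag A); split.
- exact: spectral_unitarymx.
- exact: hermitian_spectral_diag_real.
rewrite -[map_mx _ _](invmx_unitary (spectral_unitarymx A)).
exact/orthomx_spectralP/hermitian_normalmx.
Qed.

Lemma mulmx_similar (F : pzSemiRingType) n (V U A B : 'M[F]_n) :
  U *m V = 1%:M -> (V *m A *m U) *m (V *m B *m U) = V *m (A *m B) *m U.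
Proof. by move=> UV; rewrite !mulmxA -(mulmxA _ U V) UV mulmx1. Qed.

Lemma char_poly_similar (F : comNzRingType) n (V U A : 'M[F]_n) :
  V *m U = 1%:M -> char_poly (V *m A *m U) = char_poly A.
Proof.
move=> VU; rewrite /char_poly /char_poly_mx.
set V' := map_mx polyC V; set U' := map_mx polyC U; set A' := map_mx polyC A.
have VU' : V' *m U' = 1%:M by rewrite -map_mxM VU map_mx1.
have -> : 'X%:M - map_mx polyC (V *m A *m U) = V' *m ('X%:M - A') *m U'.
  rewrite !map_mxM mulmxBr mulmxBl; congr (_ - _).
  by rewrite scalar_mxC -mulmxA VU' mulmx1.
by rewrite !det_mulmx mulrAC -det_mulmx VU' det1 mul1r.
Qed.

Section Spectral.
Variable R : realType.
Local Notation toC := (complex.real_complex_def (Phant R)).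
Local Notation C := (complex.complex R).
Local Notation Re := complex.Re.
Local Notation conjC := (@Num.conj C).

Lemma Re_sum (I : finType) (F : I -> C) : Re (\sum_i F i) = \sum_i Re (F i).
Proof.
by apply: (big_ind2 (fun (z : C) (x : R) => Re z = x)) => //
  -[a b] x [c d] y <- <-.
Qed.

Lemma ReB (y z : C) : Re (y - z) = Re y - Re z.
Proof. by case: y z => a b [c d]. Qed.

Lemma Re_mul_conj (y z : C) :
  Re (y * conjC z) = Re y * Re z + complex.Im y * complex.Im z.
Proof. by case: y z => a b [c d] /=; rewrite mulrN opprK. Qed.

Lemma Im_sum (I : finType) (F : I -> C) :
  complex.Im (\sum_i F i) = \sum_i complex.Im (F i).
Proof.
by apply: (big_ind2 (fun (z : C) (x : R) => complex.Im z = x)) => //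
  -[a b] x [c d] y <- <-.
Qed.

Lemma Im_mulr_real (z : C) (x : R) : complex.Im (z * toC x) = complex.Im z * x.
Proof. by case: z => a b /=; rewrite mulr0 add0r. Qed.

Lemma Re_mulr_real (z : C) (x : R) : Re (z * toC x) = Re z * x.
Proof. by case: z => a b /=; rewrite mulr0 subr0. Qed.

(** The real part of u S u^*, with u the i-th row of U.  The eigenvectors of a
    real symmetric matrix are taken in R[i], where the spectral theorem holds;
    only these real numbers are used afterwards. *)
Definition row_expectation n (U : 'M[C]_n) (i : 'I_n) (S : 'M[R]_n) : R :=
  Re ((U *m map_mx toC S *m map_mx conjC U^T) i i).

(** Writing u = a + i b with a and b real, the real part of u S u^* is
    a S a^T + b S b^T. *)
Lemma row_expectation_ge0 n (U : 'M[C]_n) i S :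
  possemidefmx S -> 0 <= row_expectation U i S.
Proof.
move=> [_ posS].
pose a : 'cV[R]_n := \col_k Re (U i k).
pose b : 'cV[R]_n := \col_k complex.Im (U i k).
suff -> : row_expectation U i S =
    (a^T *m S *m a) ord0 ord0 + (b^T *m S *m b) ord0 ord0.
  by rewrite addr_ge0.
rewrite /row_expectation !mxE Re_sum -big_split; apply: eq_bigr => l _.
rewrite !mxE Re_mul_conj Re_sum Im_sum; congr (_ * _ + _ * _);
  by apply: eq_bigr => k _; rewrite !mxE ?Re_mulr_real ?Im_mulr_real.
Qed.

Lemma row_expectationB n (U : 'M[C]_n) i S T :
  row_expectation U i (S - T) = row_expectation U i S - row_expectation U i T.
Proof.
rewrite /row_expectation map_mxB mulmxBr mulmxBl mxE [X in _ + X]mxE.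
exact: ReB.
Qed.

Lemma row_expectation1 n (U : 'M[C]_n) i :
  U \is unitarymx -> row_expectation U i 1%:M = 1.
Proof.
move=> /unitarymxP UU; rewrite /row_expectation map_mx1 mulmx1.
by rewrite UU mxE eqxx.
Qed.

(** A real symmetric matrix is Hermitian over R[i], hence unitarily
    diagonalizable with real eigenvalues. *)
Lemma symmetric_diagonalization n (M : 'M[R]_n) : M^T = M ->
  exists (U : 'M[C]_n) (lam : 'I_n -> R), U \is unitarymx /\
    map_mx toC M =
      map_mx conjC U^T *m diag_mx (\row_i toC (lam i)) *m U.
Proof.
move=> symM; set MC := map_mx toC M.
have hermM : MC \is hermsymmx.
  apply: realsym_hermsym.
    by apply/is_hermitianmxP; rewrite expr0 scale1r map_mx_id // map_trmx symM.
  by apply/mxOverP => a b; rewrite mxE complex.complex_real /=.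
have [U [d [unitU /mxOverP reald eqM]]] := hermitian_diagonalization hermM.
have dE : \row_i toC (Re (d ord0 i)) = d.
  by apply/rowP => i; rewrite mxE RRe_real.
exists U, (fun i => Re (d ord0 i)); split; first exact: unitU.
by rewrite dE; exact: eqM.
Qed.

Lemma unitarymx_adj_mul n (U : 'M[C]_n) :
  U \is unitarymx -> map_mx conjC U^T *m U = 1%:M.
Proof. by move=> /unitarymxP /mulmx1C. Qed.

(** The trace of S M is that of U S U^* times the diagonal matrix, because the
    trace is invariant under cyclic permutations. *)
Lemma trace_expectation n (U : 'M[C]_n) (lam : 'I_n -> R) (M S : 'M[R]_n) :
  map_mx toC M = map_mx conjC U^T *m diag_mx (\row_i toC (lam i)) *m U ->
  \tr (S *m M) = \sum_i lam i * row_expectation U i S.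
Proof.
move=> eqM.
have eqtr : toC (\tr (S *m M)) =
    \sum_i (U *m map_mx toC S *m map_mx conjC U^T) i i * toC (lam i).
  rewrite -trace_map_mx map_mxM eqM !mulmxA mxtrace_mulC !mulmxA.
  by apply: eq_bigr => i _; rewrite mul_mx_diag [LHS]mxE [X in _ * X]mxE.
rewrite -[LHS]/(Re (toC _)) eqtr Re_sum; apply: eq_bigr => i _.
by rewrite Re_mulr_real mulrC.
Qed.

(** The case M = 1, all of whose eigenvalues are 1. *)
Lemma sum_row_expectation n (U : 'M[C]_n) (S : 'M[R]_n) :
  U \is unitarymx -> \sum_i row_expectation U i S = \tr S.
Proof.
move=> unitU; rewrite -[S in RHS]mulmx1 (@trace_expectation _ U (fun=> 1)).
  by apply: eq_bigr => i _; rewrite mul1r.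
have -> : diag_mx (\row_i toC 1) = 1%:M :> 'M[C]_n.
  by rewrite -diag_const_mx; congr diag_mx; apply/rowP => i; rewrite !mxE.
by rewrite map_mx1 mulmx1 unitarymx_adj_mul.
Qed.

Lemma eigenvalue_expectation n (U : 'M[C]_n) (lam : 'I_n -> R) (M : 'M[R]_n) i :
  U \is unitarymx ->
  map_mx toC M = map_mx conjC U^T *m diag_mx (\row_i toC (lam i)) *m U ->
  row_expectation U i M = lam i.
Proof.
move=> /unitarymxP UU eqM.
rewrite /row_expectation eqM !mulmxA UU mul1mx -mulmxA UU mulmx1.
by rewrite !mxE eqxx.
Qed.

(** M^T M = M^2 has the eigenvalues lam i ^+ 2, whose nonnegative square roots
    are the lam i.  The characteristic polynomials are compared over R[i], where
    M is diagonal up to similarity. *)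
Lemma singular_values_diagonalization n (U : 'M[C]_n) (lam : 'I_n -> R)
    (M : 'M[R]_n) :
  U \is unitarymx ->
  map_mx toC M = map_mx conjC U^T *m diag_mx (\row_i toC (lam i)) *m U ->
  M^T = M -> (forall i, 0 <= lam i) ->
  singular_values M [seq lam i | i <- enum 'I_n].
Proof.
move=> unitU eqM symM lam0; split=> [_ /mapP [i _ ->] //|].
rewrite symM big_map big_enum /=; apply: (map_poly_inj (real_complex R)).
rewrite map_char_poly map_mxM eqM.
have /unitarymxP UV := unitU; rewrite mulmx_similar //.
rewrite char_poly_similar ?unitarymx_adj_mul // mulmx_diag char_poly_trig.
  rewrite rmorph_prod; apply: eq_bigr => i _.
  rewrite rmorphB /= map_polyX map_polyC /= !mxE eqxx mulr1n expr2.
  by rewrite (rmorphM (real_complex R)).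
exact: diag_mx_is_trig.
Qed.

(** The trace of Y M is the sum of the eigenvalues of M with weights in [0, 1]
    of total mass n - r, so it is at least the sum of the n - r smallest
    eigenvalues.  If it is less than t, then all of these are less than t. *)
Lemma rank_tol_of_trace_lt n (M Y : 'M[R]_n) (r : nat) (t : R) :
  possemidefmx M -> possemidefmx Y -> possemidefmx (1%:M - Y) ->
  \tr Y = n%:R - r%:R -> 0 < t -> \tr (Y *m M) < t ->
  exists2 k : nat, rank_tol_is M t k & (k <= r)%N.
Proof.
move=> posM posY pos1Y trY t0 trYM; have [symM _] := posM.
have [U [lam [unitU eqM]]] := symmetric_diagonalization symM.
have lam0 i : 0 <= lam i.
  by rewrite -(eigenvalue_expectation i unitU eqM) row_expectation_ge0.
exists (count (fun s => t <= s) [seq lam i | i <- enum 'I_n]).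
  exists [seq lam i | i <- enum 'I_n] => //.
  exact: singular_values_diagonalization unitU eqM symM lam0.
have -> : count (fun s => t <= s) [seq lam i | i <- enum 'I_n] =
          #|[pred i | t <= lam i]|.
  by rewrite count_map cardE -size_filter enumT.
set B := [pred i | t <= lam i]; rewrite leqNgt; apply/negP => ltrB.
pose w i := row_expectation U i Y.
have w0 i : 0 <= w i by rewrite row_expectation_ge0.
have w1 i : w i <= 1.
  have := row_expectation_ge0 U i pos1Y.
  by rewrite row_expectationB row_expectation1 // subr_ge0.
(* The total weight n - r exceeds by at least 1 what the eigenvalues below t,
   fewer than n - r in number, can absorb. *)
have small : \sum_(i | ~~ B i) w i <= (n - #|B|)%:R.
  apply: le_trans (ler_sum _ (fun i _ => w1 i)) _.
  rewrite sumr_const ler_nat -[X in (_ <= X - _)%N](card_ord n) -(cardC B).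
  rewrite addKn.
  by apply/eq_leq/eq_card => i; rewrite !inE.
have big : 1 <= \sum_(i | B i) w i.
  have : \sum_i w i = n%:R - r%:R by rewrite sum_row_expectation.
  rewrite (bigID B) /= => /(canRL (addrK _)) ->.
  have leBn : (#|B| <= n)%N by rewrite -[X in (_ <= X)%N](card_ord n) max_card.
  rewrite natrB // in small.
  have : r.+1%:R <= #|B|%:R :> R by rewrite ler_nat.
  rewrite -natr1; move: small.
  set x := \sum_(i | _) _; set y := #|B|%:R; lra.
suff : t <= \tr (Y *m M) by rewrite leNgt trYM.
rewrite (trace_expectation Y eqM) (bigID B) -[X in X <= _]mulr1.
apply: le_trans (ler_wpM2l (ltW t0) big) _.
rewrite mulr_sumr -[X in X <= _]addr0; apply: lerD; last first.
  by apply: sumr_ge0 => i _; exact: mulr_ge0 (lam0 i) (w0 i).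
by apply: ler_sum => i Bi; exact: ler_wpM2r (w0 i) _ _ Bi.
Qed.

End Spectral.

(** * Matrices of minimal rank and kernel projections *)

Section RankFactorization.
Variable R : realType.

(** The top block row [X B^T] already has rank a, so it spans the row space and
    the bottom block row is S [X B^T] for some S.  This gives B = S X, and then
    D = S B^T = S X S^T. *)
Lemma symblock_rank_factor a b (X : 'M[R]_a) (B : 'M[R]_(b, a)) (D : 'M[R]_b) :
  X^T = X -> X \in unitmx -> \rank (symblock_mx X B D) = a ->
  exists S : 'M[R]_(b, a),
    symblock_mx X B D = col_mx 1%:M S *m X *m (col_mx 1%:M S)^T.
Proof.
move=> symX unitX rankM.
have free_top : row_free (row_mx X B^T).
  apply/row_freeP; exists (col_mx (invmx X) 0).
  by rewrite mul_row_col mulmx0 addr0 mulmxV.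
have subM : (row_mx X B^T <= symblock_mx X B D)%MS.
  by rewrite /symblock_mx /block_mx -addsmxE addsmxSl.
have [_] := mxrank_leqif_sup subM.
rewrite rankM (eqP free_top) eqxx /symblock_mx /block_mx => /esym.
rewrite col_mx_sub => /andP[_ /submxP [S]].
rewrite mul_mx_row => /eq_row_mx [eqB eqD]; exists S.
rewrite tr_col_mx trmx1 mul_col_mx mul1mx mul_col_mx !mul_mx_row !mulmx1.
by rewrite eqD eqB trmx_mul symX mulmxA.
Qed.

(** The identity block makes col_mx 1 S injective. *)
Lemma gram_unit a b (S : 'M[R]_(b, a)) :
  (col_mx 1%:M S)^T *m col_mx 1%:M S \in unitmx.
Proof.
apply: unitmx_nondegenerate => v v0; rewrite mulmxA -trmx_mul -mulmxA.
rewrite dot_gt0 // mul_col_mx mul1mx; apply: contraNneq v0 => /eqP.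
by rewrite col_mx_eq0 => /andP[].
Qed.

(** Y is the orthogonal projection onto the kernel of G^T, the complement of the
    projection E = G (G^T G)^-1 G^T onto the range of G; the trace of E is the
    trace of the identity of order a. *)
Lemma kernel_projection N a (G : 'M[R]_(N, a)) : G^T *m G \in unitmx ->
  exists Y : 'M[R]_N, [/\ possemidefmx Y, possemidefmx (1%:M - Y),
    \tr Y = N%:R - a%:R & Y *m G = 0].
Proof.
move=> unitG; pose E := G *m invmx (G^T *m G) *m G^T.
have EG : E *m G = G by rewrite /E -!mulmxA mulVmx // mulmx1.
have symE : E^T = E by rewrite /E !trmx_mul trmx_inv trmx_mul trmxK mulmxA.
have idemE : E *m E = E by rewrite {2}/E !mulmxA EG.
exists (1%:M - E); split.
- apply: possemidefmx_idempotent; first by rewrite linearB /= trmx1 symE.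
  by rewrite mulmxBl mul1mx mulmxBr mulmx1 idemE subrr subr0.
- by rewrite opprB addrC subrK; exact: possemidefmx_idempotent.
- by rewrite linearB /= mxtrace1 mxtrace_mulC mulmxA mulmxV // mxtrace1.
- by rewrite mulmxBl mul1mx EG subrr.
Qed.

End RankFactorization.

(** * Inequalities preserved by limits *)

Section Continuity.
Variables (R : realType) (T : topologicalType).

Lemma closure_ge0 (A : set T) (f : T -> R) x : continuous f ->
  (forall y, A y -> 0 <= f y) -> closure A x -> 0 <= f x.
Proof.
move=> contf f0 Ax.
have /(_ x) : closed (f @^-1` [set r | 0 <= r]).
  by apply: closed_comp => [y _|]; [exact: contf|exact: closed_ge].
by apply; apply: closureS Ax => y /f0.
Qed.

Lemma closure_eq0 (A : set T) (f : T -> R) x : continuous f ->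
  (forall y, A y -> f y = 0) -> closure A x -> f x = 0.
Proof.
move=> contf f0 Ax; apply/eqP; rewrite eq_le.
rewrite (closure_ge0 contf _ Ax) => [|y /f0 -> //]; rewrite andbT -oppr_ge0.
apply: (closure_ge0 (f := fun y => - f y) _ _ Ax) => [y|y /f0 ->].
  exact/continuousN/contf.
by rewrite oppr0.
Qed.

(** Entrywise continuity is stable under the block constructions and products
    that make up the matrix M2, by a computation on each entry. *)
Definition entry_continuous m n (F : T -> 'M[R]_(m, n)) :=
  forall a b, continuous (fun x => F x a b).

Lemma continuous_sum_fun (I : finType) (f : I -> T -> R) :
  (forall i, continuous (f i)) -> continuous (fun x => \sum_i f i x).
Proof.
by move=> contf; apply: continuous_big => [|i _]; [exact: add_continuous|].
Qed.

Lemma entry_continuous_cst m n (A : 'M[R]_(m, n)) : entry_continuous (fun=> A).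
Proof. by move=> a b x; exact: cvg_cst. Qed.

Lemma entry_continuous_of m n (F : T -> 'M[R]_(m, n)) :
  continuous F -> entry_continuous F.
Proof.
move=> contF a b x.
apply: (@continuous_comp _ _ _ F (fun A : 'M[R]_(m, n) => A a b)).
  exact: contF.
exact: coord_continuous.
Qed.

Lemma entry_continuous_mul m n k (F : T -> 'M[R]_(m, n))
    (G : T -> 'M[R]_(n, k)) :
  entry_continuous F -> entry_continuous G ->
  entry_continuous (fun x => F x *m G x).
Proof.
move=> contF contG a b.
under eq_fun do rewrite mxE.
apply: continuous_sum_fun => c x.
by apply: continuousM; [exact: contF|exact: contG].
Qed.

Lemma entry_continuous_tr m n (F : T -> 'M[R]_(m, n)) :
  entry_continuous F -> entry_continuous (fun x => (F x)^T).
Proof. by move=> contF a b; under eq_fun do rewrite mxE; exact: contF. Qed.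

Lemma entry_continuousB m n (F G : T -> 'M[R]_(m, n)) :
  entry_continuous F -> entry_continuous G ->
  entry_continuous (fun x => F x - G x).
Proof.
move=> contF contG a b; under eq_fun do rewrite mxE [X in _ + X]mxE.
by move=> x; apply: continuousB; [exact: contF|exact: contG].
Qed.

Lemma entry_continuous_col_mx m1 m2 n (F : T -> 'M[R]_(m1, n))
    (G : T -> 'M[R]_(m2, n)) :
  entry_continuous F -> entry_continuous G ->
  entry_continuous (fun x => col_mx (F x) (G x)).
Proof.
move=> contF contG a b; under eq_fun do rewrite mxE.
case: (fintype.split a) => c; [exact: contF|exact: contG].
Qed.

Lemma entry_continuous_symblock n1 n2 (F : T -> 'M[R]_n1)
    (G : T -> 'M[R]_(n2, n1)) (H : T -> 'M[R]_n2) :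
  entry_continuous F -> entry_continuous G -> entry_continuous H ->
  entry_continuous (fun x => symblock_mx (F x) (G x) (H x)).
Proof.
move=> contF contG contH; apply: entry_continuous_col_mx => a b;
  under eq_fun do rewrite mxE; case: (fintype.split b) => c.
- exact: contF.
- exact: entry_continuous_tr.
- exact: contG.
exact: contH.
Qed.

Lemma closure_possemidef n (A : set T) (F : T -> 'M[R]_n) x :
  entry_continuous F -> (forall y, A y -> possemidefmx (F y)) ->
  closure A x -> possemidefmx (F x).
Proof.
move=> contF posF Ax; split=> [|v].
  apply/matrixP => a b; rewrite mxE; apply/eqP; rewrite -subr_eq0; apply/eqP.
  apply: (closure_eq0 (f := fun y => F y b a - F y a b) _ _ Ax) => [y|y].
    by apply: continuousB; exact: contF.
  by move=> /posF [symF _]; rewrite -{1}symF mxE subrr.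
apply: (closure_ge0 (f := fun y => (v^T *m F y *m v) ord0 ord0) _ _ Ax).
  apply: entry_continuous_mul; last exact: entry_continuous_cst.
  by apply: entry_continuous_mul contF; exact: entry_continuous_cst.
by move=> y /posF [].
Qed.

End Continuity.

Lemma continuous_fst_of (S T U : topologicalType) (g : S -> T * U) :
  continuous g -> continuous (fun x => (g x).1).
Proof.
move=> contg x; apply: (@continuous_comp _ _ _ g fst); first exact: contg.
exact: cvg_fst.
Qed.

Lemma continuous_snd_of (S T U : topologicalType) (g : S -> T * U) :
  continuous g -> continuous (fun x => (g x).2).
Proof.
move=> contg x; apply: (@continuous_comp _ _ _ g snd); first exact: contg.
exact: cvg_snd.
Qed.

(** * Lifting (R1) to (R2), and limits of feasible points of (R2) *)

Section Limits.
Variables (R : realType) (n m p q i j : nat) (P : problem_data R n m p q i j).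

Lemma entry_continuous_M2 (T : topologicalType) (z : T -> decision R n m q) :
  entry_continuous (fun x => zK (z x)) ->
  entry_continuous (fun x => zX1 (z x)) ->
  entry_continuous (fun x => zX2 (z x)) ->
  entry_continuous (fun x => zY1 (z x)) ->
  entry_continuous (fun x => zY2 (z x)) ->
  entry_continuous (fun x => zF22 (z x)) ->
  entry_continuous (fun x => zF33 (z x)) ->
  entry_continuous (fun x => zF43 (z x)) ->
  entry_continuous (fun x => zF44 (z x)) ->
  entry_continuous (fun x => M2 P (z x)).
Proof.
move=> cK cX1 cX2 cY1 cY2 cF22 cF33 cF43 cF44.
apply: entry_continuous_symblock => //.
  apply: entry_continuous_col_mx; first exact: entry_continuous_tr.
  by apply: entry_continuous_col_mx => //; exact: entry_continuous_cst.
apply: entry_continuous_symblock => //; last exact: entry_continuous_symblock.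
apply: entry_continuous_col_mx => //; apply: entry_continuous_tr.
by apply: entry_continuous_mul => //; exact: entry_continuous_cst.
Qed.

Definition coord_space : topologicalType :=
  ('M[R]_(M2_dim n m) * 'M[R]_(m, q) * R * R * R * R * 'M[R]_(n + n) *
   'M[R]_(n + n) * 'M[R]_(n + n, m) * 'M[R]_(n + n, m) * 'M[R]_m *
   'M[R]_(n + n) * 'M[R]_(n + n) * 'M[R]_(n + n))%type.

(** The inverse of [coords], written with projections so that each decision
    variable is an iterated first or second projection, hence continuous. *)
Definition of_coords (c : coord_space) :
    'M[R]_(M2_dim n m) * decision R n m q :=
  let c2 := c.1 in let c3 := c2.1 in let c4 := c3.1 in let c5 := c4.1 in
  let c6 := c5.1 in let c7 := c6.1 in let c8 := c7.1 in let c9 := c8.1 in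
  let c10 := c9.1 in let c11 := c10.1 in let c12 := c11.1 in let c13 := c12.1 in
  (c13.1,
   Decision c13.2 c12.2 c11.2 c10.2 c9.2 c8.2 c7.2 c6.2 c5.2 c4.2 c3.2 c2.2
     c.2).

Lemma coordsK Yz : of_coords (coords Yz) = Yz.
Proof. by case: Yz => Y []. Qed.

(** Continuity of one of the coordinates of a nested tuple. *)
Ltac project_continuous :=
  rewrite /of_coords /=;
  repeat match goal with
  | |- forall x, continuous_at x (fun c => fst (@?g c)) =>
    apply: continuous_fst_of
  | |- forall x, continuous_at x (fun c => snd (@?g c)) =>
    apply: continuous_snd_of
  end;
  by move=> ?; first [exact: cvg_fst | exact: cvg_snd | exact: cvg_id].

Lemma continuous_Y : entry_continuous (fun c => (of_coords c).1).
Proof. by apply: entry_continuous_of; project_continuous. Qed.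

Lemma continuous_M2 : entry_continuous (fun c => M2 P (of_coords c).2).
Proof.
apply: entry_continuous_M2; apply: entry_continuous_of; project_continuous.
Qed.

Lemma feasible_R2_closure (Y : 'M[R]_(M2_dim n m)) (z : decision R n m q) :
  closure (@coords R n m q @` feasible_R2 P) (coords (Y, z)) ->
  [/\ possemidefmx Y, possemidefmx (1%:M - Y), \tr Y = (4 * n + m)%:R &
      possemidefmx (M2 P z)].
Proof.
move=> clYz.
have feasible_of_coords c : (@coords R n m q @` feasible_R2 P) c ->
    feasible_R2 P ((of_coords c).1, (of_coords c).2).
  by move=> [Yz feasYz <-]; rewrite coordsK -surjective_pairing.
rewrite -[Y]/((Y, z).1) -[z]/((Y, z).2) -(coordsK (Y, z)).
split.
- rewrite -[X in possemidefmx X]subr0.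
  apply: (closure_possemidef
           (F := fun c : coord_space => (of_coords c).1 - 0) _ _ clYz).
    by apply: entry_continuousB continuous_Y _; exact: entry_continuous_cst.
  by move=> c /feasible_of_coords [_ _ [? _]].
- apply: (closure_possemidef
           (F := fun c : coord_space => 1%:M - (of_coords c).1) _ _ clYz).
    by apply: entry_continuousB _ continuous_Y; exact: entry_continuous_cst.
  by move=> c /feasible_of_coords [_ _ [_ ?]].
- apply/eqP; rewrite -subr_eq0; apply/eqP.
  apply: (closure_eq0 (f := fun c : coord_space =>
           \tr (of_coords c).1 - (4 * n + m)%:R) _ _ clYz) => [c|c].
    apply: (@continuousB _ _ _ (fun c : coord_space => \tr (of_coords c).1)
              (fun=> (4 * n + m)%:R)); last exact: cvg_cst.
    by apply: continuous_sum_fun => a; exact: continuous_Y.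
  by move=> /feasible_of_coords [_ _ _ -> _]; rewrite subrr.
apply: (closure_possemidef
         (F := fun c : coord_space => M2 P (of_coords c).2) _ _ clYz).
  exact: continuous_M2.
by move=> c /feasible_of_coords [].
Qed.

Lemma constraints_L_eps_S_ge0 (z : decision R n m q) :
  constraints_L P z -> 0 <= zeps_S z.
Proof.
move=> [_ [posX1 _] _ lt_tr _]; apply: le_trans (ltW lt_tr).
exact/possemidefmx_tr_ge0/possemidefmx_congr/posdefmx_possemidef.
Qed.

(** eps_y is a diagonal entry of the positive definite matrix - lmi2 z. *)
Lemma constraints_L_eps_y_ge0 (z : decision R n m q) :
  (0 < p + q)%N -> constraints_L P z -> 0 <= zeps_y z.
Proof.
rewrite addn_gt0 => pq [_ _ _ _ [_ neg2]].
have [p0|q0] := orP pq.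
  have := posdefmx_diag_gt0
    (rshift (n + n)%N (lshift (q + j) (Ordinal p0))) neg2.
  rewrite /lmi2 mxE /symblock_mx block_mxEdr block_mxEul.
  by rewrite !mxE eqxx opprK => /ltW.
have := posdefmx_diag_gt0
  (rshift (n + n)%N (rshift p (lshift j (Ordinal q0)))) neg2.
rewrite /lmi2 mxE /symblock_mx !block_mxEdr block_mxEul.
by rewrite !mxE eqxx opprK => /ltW.
Qed.

Lemma cost_R1_ge0_closure lambda1 lambda2 (W : 'M[R]_(m, q))
    (Y : 'M[R]_(M2_dim n m)) (z : decision R n m q) :
  0 <= lambda1 -> 0 <= lambda2 -> (0 < p + q)%N ->
  closure (@coords R n m q @` feasible_R2 P) (coords (Y, z)) ->
  0 <= cost_R1 lambda1 lambda2 W z.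
Proof.
move=> l1 l2 pq clYz; rewrite /cost_R1.
have feasible_of_coords c : (@coords R n m q @` feasible_R2 P) c ->
    constraints_L P (of_coords c).2.
  by move=> [[Y' z'] [_ Lz' _ _ _] <-]; rewrite coordsK.
rewrite !addr_ge0 ?mulr_ge0 //.
- rewrite -[z]/((Y, z).2) -(coordsK (Y, z)).
  apply: (closure_ge0 (f := fun c : coord_space => zeps_S (of_coords c).2)
           _ _ clYz) => [|c]; first by project_continuous.
  by move=> /feasible_of_coords /constraints_L_eps_S_ge0.
- rewrite -[z]/((Y, z).2) -(coordsK (Y, z)).
  apply: (closure_ge0 (f := fun c : coord_space => zeps_y (of_coords c).2)
           _ _ clYz) => [|c]; first by project_continuous.
  by move=> /feasible_of_coords /(constraints_L_eps_y_ge0 pq).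
by apply: sumr_ge0 => a _; apply: sumr_ge0.
Qed.

Definition set_eps_y (z : decision R n m q) (e : R) :=
  Decision (zK z) e (zeps_S z) (zeps1 z) (zeps2 z) (zX1 z) (zX2 z) (zY1 z)
    (zY2 z) (zF22 z) (zF33 z) (zF43 z) (zF44 z).

(** The blocks of lmi2 holding eps_y are empty when p = q = 0. *)
Lemma feasible_R2_set_eps_y Y (z : decision R n m q) (e : R) :
  (p + q)%N = 0%N -> feasible_R2 P (Y, z) -> feasible_R2 P (Y, set_eps_y z e).
Proof.
move=> /eqP; rewrite addn_eq0 => /andP[/eqP p0 /eqP q0].
move=> [sym [KP posX eps12 trS [neg1 neg2]] boundY trY posM].
have empty k (k0 : k = 0%N) (A B : 'M[R]_k) : A = B.
  by apply/matrixP => -[a lt_a]; exfalso; rewrite k0 in lt_a.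
have lmi2E : lmi2 P (set_eps_y z e) = lmi2 P z.
  rewrite /lmi2 /= (empty p p0 (- e%:M) (- (zeps_y z)%:M)).
  by rewrite (empty q q0 (- e%:M) (- (zeps_y z)%:M)).
split; [exact: sym| |exact: boundY|exact: trY|exact: posM].
split; [exact: KP|exact: posX|exact: eps12|exact: trS|split].
  exact: neg1.
by rewrite lmi2E; exact: neg2.
Qed.

(** Y is the projection onto the kernel of M2 z = G X1 G^T. *)
Lemma feasible_R1_lift (z : decision R n m q) : feasible_R1 P z ->
  exists2 Y, feasible_R2 P (Y, z) & \tr (Y *m M2 P z) = 0.
Proof.
move=> [sym Lz rankM]; have [_ [posX1 _] _ _ _] := Lz.
have [symX1 posX1'] := posX1.
have rankM' : \rank (M2 P z) = (n + n)%N by rewrite rankM mul2n addnn.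
have [S] := symblock_rank_factor symX1 (unitmx_nondegenerate posX1') rankM'.
rewrite -[symblock_mx _ _ _]/(M2 P z) => eqM.
have [Y [posY pos1Y trY YG]] := kernel_projection (gram_unit S).
exists Y; last by rewrite eqM !mulmxA YG !mul0mx mxtrace0.
split; [exact: sym|exact: Lz| | |].
- by split; [rewrite /lemx subr0|exact: pos1Y].
- rewrite trY -natrB; last by rewrite leq_addr.
  by congr _%:R; lia.
by rewrite eqM; exact/possemidefmx_congr/posdefmx_possemidef.
Qed.

End Limits.

Theorem theorem6 (R : realType) (n m p q i j : nat)
    (P : problem_data R n m p q i j)
    (lambda1 lambda2 : R) (W : 'M[R]_(m, q))
    (hctrl : controllable (dA P) (dB1 P))
    (hdet : detectable (dA P) (dC P))
    (hrho : 0 <= drho P)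
    (hKset : convex_set (dKset P : set (convex_lmodType 'M[R]_(m, q))))
    (hlambda1 : 0 < lambda1) (hlambda2 : 0 < lambda2)
    (hW : forall a b, 0 < W a b)
    (hR1 : exists z : decision R n m q, feasible_R1 P z) :
  exists2 eta : R, 0 < eta &
    forall nu : R, 0 < nu ->
    forall (Y : 'M[R]_(M2_dim n m)) (z : decision R n m q),
      optimal_R2 P lambda1 lambda2 nu W (Y, z) ->
      exists2 k : nat, rank_tol_is (M2 P z) (eta / nu) k & (k <= 2 * n)%N.
Proof.
have [z0 /feasible_R1_lift [Y0 feas0 tr0]] := hR1.
pose c0 := cost_R1 lambda1 lambda2 W z0.
exists (`|c0| + 1); first by rewrite ltr_wpDl.
move=> nu nu0 Y z [clYz optYz].
have [pq0|pq_gt0] := posnP (p + q).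
  (* With eps_y = e the lifted point costs 1 less than the optimum. *)
  exfalso; pose e := (cost_R2 P lambda1 lambda2 nu W (Y, z) - c0 - 1) / lambda1
    + zeps_y z0.
  have := optYz _ (feasible_R2_set_eps_y e pq0 feas0).
  rewrite leNgt => /negP; apply.
  rewrite {1}/cost_R2 /= -[M2 P (set_eps_y z0 e)]/(M2 P z0) tr0 mulr0 addr0.
  rewrite {1}/cost_R1 /= {1}/e mulrDr mulrCA divff ?gt_eqF // mulr1.
  rewrite /c0 /cost_R1; lra.
have [posY pos1Y trY posM] := feasible_R2_closure clYz.
apply: (rank_tol_of_trace_lt posM posY pos1Y).
- rewrite trY -natrB /M2_dim; first by congr _%:R; lia.
  lia.
- by rewrite divr_gt0 // ltr_wpDl.
have := optYz _ feas0; rewrite /cost_R2 /= tr0 mulr0 addr0 -/c0 => le_cost.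
have cost0 := cost_R1_ge0_closure W (ltW hlambda1) (ltW hlambda2) pq_gt0 clYz.
rewrite ltr_pdivlMr // mulrC.
have := ler_norm c0; lra.
Qed.
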